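(* Let $n,d$ be positive integers. There exists a fundamental model in $\Delta_n$ of degree $d$ if $n\le d\le 2n-1$.
   Context: A reduced model in the probability simplex $\Delta_n=\{p\in\mathbb{R}^{n+1}\mid \sum_i p_i=1,\ p_i\ge 0\}$ is given by a collection of $n+1$ triples $(c_i,\nu_i,\mu_i)_{i=0}^n$ with $c_i\in\mathbb{R}_{>0}$ and $\nu_i,\mu_i\in\mathbb{N}=\{0,1,2,\ldots\}$ such that the pairs $(\nu_i,\mu_i)$ are pairwise distinct and all different from $(0,0)$, and $\sum_{i=0}^n c_i t^{\nu_i}(1-t)^{\mu_i}=1$ for all $t\in[0,1]$. Its degree is $\max_i(\nu_i+\mu_i)$. It is fundamental if, given the exponent pairs $(\nu_i,\mu_i)$, the scalings $c_i$ are uniquely determined by the constraint $\sum_{i=0}^n c_i t^{\nu_i}(1-t)^{\mu_i}=1$ (as a polynomial identity in $t$). *)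

(* Defs.v *)
From HB Require Import structures.
From mathcomp Require Import all_boot all_order all_algebra.
From mathcomp Require Import reals.

Set Implicit Arguments.
Unset Strict Implicit.
Unset Printing Implicit Defensive.

Import Order.TTheory GRing.Theory Num.Theory.
Local Open Scope ring_scope.

Record reduced_model (R : realType) (n : nat) := ReducedModel {
  scaling : 'I_n.+1 -> R;
  nu : 'I_n.+1 -> nat;
  mu : 'I_n.+1 -> nat;
  scaling_gt0 : forall i, 0 < scaling i;
  exponents_inj : injective (fun i => (nu i, mu i));
  exponents_neq0 : forall i, (nu i, mu i) <> (0%N, 0%N);
  sum_to_one : forall t : R, 0 <= t <= 1 ->
    \sum_(i < n.+1) scaling i * t ^+ nu i * (1 - t) ^+ mu i = 1
}.

Definition degree (R : realType) (n : nat) (M : reduced_model R n) : nat :=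
  \max_(i < n.+1) (nu M i + mu M i)%N.

(* Uniqueness is required among all real scalings. Requiring it only among
   positive ones is equivalent: since [scaling M] is positive, a second real
   solution would yield further positive ones close to [scaling M]. *)
Definition fundamental (R : realType) (n : nat) (M : reduced_model R n) : Prop :=
  forall c : 'I_n.+1 -> R,
    \sum_(i < n.+1) c i *: ('X^(nu M i) * (1 - 'X) ^+ mu M i) = 1 :> {poly R} ->
    c =1 scaling M.

(* Main.v *)
Require Import Defs.
From HB Require Import structures.
From mathcomp Require Import all_boot all_order all_algebra.
From mathcomp Require Import reals.
From mathcomp Require Import zify ring.

(** Put r = d - n and write x = t, y = 1 - t. The Lucas polynomials
    L_0 = 2, L_1 = x, L_(m+2) = x L_(m+1) + y L_m satisfy
    L_m = 1 + (-y)^m on the line x + y = 1, since the roots of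
    z^2 - x z - y are then 1 and -y. Hence L_(2r+1) + y^(2r+1) = 1, which is a
    model of degree 2r+1 in the simplex of dimension r+1 whose x-exponents are
    the odd numbers up to 2r+1, and 0. Replacing its monomial x^(2r+1) by
    x^(2r+1) y + x^(2r+2) y + ... + x^(d-1) y + x^d raises degree and dimension
    simultaneously, up to d and n. The x-exponents remain pairwise distinct, so
    the monomials have distinct orders of vanishing at t = 0, are linearly
    independent, and the model is fundamental. *)

Set Implicit Arguments.
Unset Strict Implicit.
Unset Printing Implicit Defensive.

Import Order.TTheory GRing.Theory Num.Theory.
Local Open Scope ring_scope.

(* [lucas m j] is the coefficient of [x ^ (m - 2j) * y ^ j] in [L_m]. *)
Fixpoint lucas (m j : nat) : nat :=
  match m with
  | 0 => if j is 0 then 2 else 0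
  | m'.+1 =>
    if m' is m''.+1 then
      (lucas m' j + if j is j'.+1 then lucas m'' j' else 0)%N
    else j == 0%N
  end.

Arguments lucas : simpl never.

Lemma lucasSS m j :
  lucas m.+2 j = (lucas m.+1 j + if j is j'.+1 then lucas m j' else 0)%N.
Proof. by []. Qed.

Lemma nat_ind2 (P : nat -> Prop) :
  P 0 -> P 1 -> (forall m, P m -> P m.+1 -> P m.+2) -> forall m, P m.
Proof.
move=> P0 P1 PS m; suff [] : P m /\ P m.+1 by [].
by elim: m => [|m [Pm PSm]]; split=> //; apply: PS.
Qed.

Lemma lucasS0 m : lucas m.+1 0 = 1%N.
Proof. by elim: m => // m IHm; rewrite lucasSS IHm. Qed.

Lemma lucas_gt0 m j : (j.*2 <= m)%N -> (0 < lucas m j)%N.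
Proof.
elim/nat_ind2: m j => [|| m IHm _] [|j] //; first by rewrite lucasS0.
by rewrite doubleS !ltnS lucasSS => le_jm; rewrite addn_gt0 IHm // orbT.
Qed.

Lemma lucas_eq0 m j : (m < j.*2)%N -> lucas m j = 0%N.
Proof.
elim/nat_ind2: m j => [|| m IHm IHSm] [|j] // lt_mj.
by rewrite lucasSS IHSm ?IHm //; lia.
Qed.

(** The bound [N] is free because coefficients past m/2 vanish; the induction uses this to apply
    both hypotheses with different bounds. *)
Lemma sum_lucas (R : comNzRingType) (x : R) m N : (m < N.*2)%N ->
  \sum_(j < N) (lucas m j)%:R * x ^+ (m - j.*2) * (1 - x) ^+ j =
  1 + (x - 1) ^+ m.
Proof.
elim/nat_ind2: m N => [|| m IHm IHSm] [|N] // lt_mN.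
- rewrite big_ord_recl big1 => [|i _] /=; last by rewrite {1}/lucas mulr0n !mul0r.
  by rewrite /lucas /= !expr0; ring.
- rewrite big_ord_recl big1 => [|i _] /=; last by rewrite {1}/lucas mulr0n !mul0r.
  by rewrite /lucas /= !expr0 expr1; ring.
have {}IHm := IHm N ltac:(lia); have {}IHSm := IHSm N.+1 ltac:(lia).
transitivity (x * (1 + (x - 1) ^+ m.+1) + (1 - x) * (1 + (x - 1) ^+ m)); last first.
  by rewrite !exprS; ring.
rewrite -IHm -IHSm !mulr_sumr [in RHS]big_ord_recl [in LHS]big_ord_recl -addrA.
rewrite -big_split /=; congr (_ + _).
  by rewrite !lucasS0 !subn0 expr0 [x ^+ m.+2]exprS; ring.
apply: eq_bigr => j _; rewrite /bump add1n lucasSS natrD (_ : (m.+2 - j.+1.*2 = m - j.*2)%N); last lia.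
(* Truncated subtraction gives the right exponent only in the first case; in the second,
   [lucas m.+1 j.+1] is zero. *)
have [le_jm|lt_mj] := leqP j.+1.*2 m.+1.
  rewrite (_ : (m - j.*2 = (m.+1 - j.+1.*2).+1)%N); last lia.
  by rewrite !exprS; ring.
by rewrite (lucas_eq0 lt_mj) !exprS; ring.
Qed.

(** Once all terms of order below [k] are gone, only the one with [e i = k] contributes to the
    coefficient of degree [k]. *)
Lemma lin_indep_distinct_order (R : idomainType) (I : finType)
    (c : I -> R) (e : I -> nat) (q : I -> {poly R}) :
    injective e -> (forall i, (q i)`_0 != 0) ->
  \sum_i c i *: ('X^(e i) * q i) = 0 -> forall i, c i = 0.
Proof.
move=> e_inj q0 sum0; have c_eq0 k : forall i, (e i < k)%N -> c i = 0.
  elim: k => // k IHk i; rewrite ltnS leq_eqVlt => /orP[/eqP ei|]; last exact: IHk.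
  have := congr1 (fun p : {poly R} => p`_k) sum0.
  rewrite coef_sum coef0 (bigD1 i) //= big1 => [|j ji].
    rewrite addr0 coefZ coefXnM ei ltnn subnn => /eqP.
    by rewrite mulf_eq0 (negPf (q0 i)) orbF => /eqP.
  rewrite coefZ coefXnM; case: ltnP => [_|]; first by rewrite mulr0.
  rewrite leq_eqVlt => /orP[/eqP ej|/IHk->]; last by rewrite mul0r.
  by rewrite (e_inj j i) ?eqxx // in ji; rewrite ej ei.
by move=> i; apply: (c_eq0 (e i).+1).
Qed.

(** Each monomial vanishes at 0 to order exactly [nu M i], as powers of [1 - 'X] have constant
    coefficient 1. *)
Lemma fundamental_nu_inj (R : realType) (n : nat) (M : reduced_model R n) :
  injective (nu M) -> fundamental M.
Proof.
move=> nu_inj c sum_c i; apply/eqP; rewrite -subr_eq0; apply/eqP; move: i.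
apply: (lin_indep_distinct_order (q := fun i => (1 - 'X) ^+ mu M i) nu_inj) => [i|].
  by rewrite -horner_coef0 !hornerE subr0 expr1n oner_neq0.
under eq_bigr do rewrite scalerBl.
rewrite big_split /= sumrN sum_c.
(* Both sides agree on the infinite set [0, 1], hence as polynomials. *)
set p : {poly R} := \sum_(i < _) _.
pose s := [seq (k.+1%:R : R)^-1 | k <- iota 0 (size (1 - p))].
apply: (@roots_geq_poly_eq0 _ _ s); last by rewrite size_map size_iota.
- apply/allP=> _ /mapP[k _ ->].
  rewrite /root !hornerE subr_eq0 eq_sym horner_sum; apply/eqP.
  rewrite -[RHS](@sum_to_one _ _ M (k.+1%:R)^-1).
    by apply: eq_bigr => i _; rewrite !hornerE.
  by rewrite invr_ge0 ler0n invf_le1 ?ltr0n // ler1n.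
- rewrite map_inj_uniq ?iota_uniq // => k l /invr_inj/eqP.
  by rewrite eqr_nat => /eqP[].
Qed.

Section Model.

Variables (R : realType) (r k : nat).

Let n := (r + k).+1.

(** Index 0 is y^(2r+1); i in 1..r is the Lucas monomial with j = r+1-i; i above r is the tail
    x^(r+i) y, without the y at i = n. *)
Definition model_nu (i : nat) : nat := if (i <= r)%N then i.*2.-1 else (r + i)%N.

Definition model_mu (i : nat) : nat :=
  if i == 0%N then r.*2.+1 else if (i <= r)%N then (r.+1 - i)%N else (i < n)%N.

Definition model_scaling (i : nat) : R :=
  if (0 < i <= r)%N then (lucas r.*2.+1 (r.+1 - i))%:R else 1.

Lemma model_scaling_gt0 i : 0 < model_scaling i.
Proof.
rewrite /model_scaling; case: ifP => [ir|_]; last exact: ltr01.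
by rewrite ltr0n lucas_gt0 //; lia.
Qed.

Lemma model_nu_inj : injective model_nu.
Proof. by move=> i j; rewrite /model_nu;
  case: (leqP i r) => ?; case: (leqP j r) => ? ?; lia. Qed.

Lemma model_exponents_neq0 i : (model_nu i, model_mu i) <> (0%N, 0%N).
Proof.
rewrite /model_nu /model_mu; case: eqP => [->|i0] //=.
by case: (leqP i r) => ir []; lia.
Qed.

Lemma model_degree_le i :
  (i <= n)%N -> (model_nu i + model_mu i <= r + n)%N.
Proof.
rewrite /model_nu /model_mu /n; case: eqP => [->|i0] /=; first lia.
by case: (leqP i r); lia.
Qed.

Lemma model_sum (t : R) :
  \sum_(i < n.+1) model_scaling i * t ^+ model_nu i * (1 - t) ^+ model_mu i = 1.
Proof.
pose F i := model_scaling i * t ^+ model_nu i * (1 - t) ^+ model_mu i.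
rewrite -(big_mkord predT F) /F.
rewrite big_nat_recl // (@big_cat_nat _ _ _ r) //=; last by rewrite /n; lia.
(* The Lucas sum read backwards, without its term j = 0, the monomial x^(2r+1) to be replaced. *)
have head : \sum_(0 <= i < r) model_scaling i.+1 * t ^+ model_nu i.+1 *
    (1 - t) ^+ model_mu i.+1 = 1 + (t - 1) ^+ r.*2.+1 - t ^+ r.*2.+1.
  rewrite -(@sum_lucas _ _ _ r.+1) // big_ord_recl lucasS0 subn0 expr0 mul1r mulr1.
  rewrite addrAC subrr add0r big_nat_rev big_mkord; apply: eq_bigr => i _.
  have ir := ltn_ord i.
  rewrite lift0 /model_scaling /model_nu /model_mu /= add0n.
  rewrite (_ : (r - i.+1 < r)%N = true); last lia.
  rewrite (_ : r.+1 - (r - i.+1).+1 = i.+1)%N; last lia.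
  by rewrite (_ : (r - i.+1).*2.+1 = r.*2.+1 - i.+1.*2)%N //; lia.
(* As x^m (1-x) = x^m - x^(m+1), the sum telescopes, and the last monomial x^(r+n) cancels the
   remainder. *)
have tail : \sum_(r <= i < n) model_scaling i.+1 * t ^+ model_nu i.+1 *
    (1 - t) ^+ model_mu i.+1 = t ^+ r.*2.+1.
  rewrite big_nat_recr /=; last by rewrite /n; lia.
  rewrite (eq_big_nat _ _ (F2 := fun i =>
      - (t ^+ (r + i.+1).+1 - t ^+ (r + i.+1)))); last first.
    move=> i ri; rewrite /model_scaling /model_nu /model_mu /n /=.
    rewrite !(leqNgt i.+1 r) ltnS (_ : (r <= i)%N) //=; last lia.
    by rewrite (_ : (i.+1 < (r + k).+1)%N) /=; [rewrite expr1 exprS; ring | lia].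
  rewrite sumrN; under eq_bigr do rewrite -addnS.
  rewrite (telescope_sumr (fun i => t ^+ (r + i.+1))); last lia.
  rewrite /model_scaling /model_nu /model_mu /n /=.
  rewrite (_ : (r + k < r)%N = false) ?ltnn /=; last lia.
  by rewrite -addnn -(addnS r r) expr0 mul1r mulr1; ring.
rewrite head tail /model_scaling /model_nu /model_mu /= expr0.
(* The index 0 term cancels (t-1)^(2r+1) because 2r+1 is odd. *)
rewrite -(opprB t 1) exprNn -signr_odd /= odd_double /= expr1; ring.
Qed.

Definition lucas_model : reduced_model R n :=
  @ReducedModel R n (fun i => model_scaling i) (fun i => model_nu i)
    (fun i => model_mu i) (fun i => model_scaling_gt0 i)
    (fun i j eq_ij => val_inj (model_nu_inj (congr1 fst eq_ij)))
    (fun i => @model_exponents_neq0 i) (fun t _ => model_sum t).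

Lemma lucas_model_fundamental : fundamental lucas_model.
Proof. by apply: fundamental_nu_inj => i j /model_nu_inj/val_inj. Qed.

Lemma degree_lucas_model : degree lucas_model = (r + n)%N.
Proof.
apply/eqP; rewrite eqn_leq; apply/andP; split.
  by apply/bigmax_leqP => i _; apply: model_degree_le; rewrite -ltnS.
(* The last monomial, x^(r+n), attains the bound. *)
apply: (leq_trans _ (leq_bigmax ord_max)) => /=.
by rewrite /model_nu /n; case: (leqP _ r); lia.
Qed.

End Model.

Theorem proposition6p2 (R : realType) (n d : nat) (n_gt0 : (0 < n)%N)
    (d_gt0 : (0 < d)%N) (n_le_d : (n <= d)%N) (d_le : (d <= 2 * n - 1)%N) :
  exists M : reduced_model R n, fundamental M /\ degree M = d.
Proof.
(* Solves d = r + n and n = r + k + 1 for r and k; the two bounds on d make both differences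
   nonnegative. *)
have -> : n = (d - n + (2 * n - 1 - d)).+1 by lia.
exists (lucas_model R (d - n) (2 * n - 1 - d)).
split; first exact: lucas_model_fundamental.
by rewrite degree_lucas_model; lia.
Qed.
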